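(* Let $F$ be an arbitrary field of characteristic $\ell$, let $V$ be a non-zero finite dimensional vector space over $F$, and let $f:V\times V\to F$ be a bilinear form. Then the Lie algebra $L(f)$ is semisimple if and only if $\ell\neq 2$, $f$ is non-degenerate and $f=f_1\perp f_{-1}$, where $f_1$ is symmetric, $\dim(V_1)\neq 2$, and $f_{-1}$ is skew-symmetric.
   Context: $L(f)=\{x\in\mathfrak{gl}(V)\mid f(xv,w)=-f(v,xw)\ \text{for all } v,w\in V\}$. A Lie algebra is semisimple if its only solvable ideal is $0$ (so the zero Lie algebra is semisimple). If $f$ is non-degenerate, its asymmetry $\sigma\in\mathrm{GL}(V)$ is defined by $f(w,v)=f(v,\sigma w)$ for all $v,w\in V$. For $\lambda\in F$, $V_\lambda=\{v\in V\mid (\sigma-\lambda)^m v=0\text{ for some } m\ge1\}$, and for $\lambda=\pm1$, $f_{\lambda}$ denotes the restriction of $f$ to $V_{\lambda}$. The notation $f=f_1\perp f_{-1}$ means $V=V_1\oplus V_{-1}$ with $f(V_1,V_{-1})=0=f(V_{-1},V_1)$; either of $V_1,V_{-1}$ may be zero. *)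

(* Defs.v *)
From HB Require Import structures.
From mathcomp Require Import all_boot all_order all_algebra.

Set Implicit Arguments.
Unset Strict Implicit.
Unset Printing Implicit Defensive.

Import GRing.Theory.
Local Open Scope ring_scope.

Section LieSubalgebras.
Variables (F : fieldType) (V : vectType F).
Implicit Types (x y : 'End(V)) (L I U W : {vspace 'End(V)}).

Definition lie_bracket x y : 'End(V) := ((x \o y) - (y \o x))%VF.

Definition lie_ideal L I : Prop :=
  (I <= L)%VS /\ forall x y, x \in L -> y \in I -> lie_bracket x y \in I.

(* The span of all brackets of elements of U: by bilinearity a basis of U     *)
(* suffices, see lie_derivedP.                                                *)
Definition lie_derived U : {vspace 'End(V)} :=
  <<[seq lie_bracket x y | x <- vbasis U, y <- vbasis U]>>%VS.

Definition lie_solvable U : Prop :=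
  exists n : nat, iter n lie_derived U = 0%VS.

(* L is meant to be a Lie subalgebra of gl(V).                                *)
Definition lie_semisimple L : Prop :=
  forall I, lie_ideal L I -> lie_solvable I -> I = 0%VS.

Lemma lie_bracket_suml (J : finType) (a : J -> F) (u : J -> 'End(V)) y :
  lie_bracket (\sum_j a j *: u j) y = \sum_j a j *: lie_bracket (u j) y.
Proof.
have lin : linear (lie_bracket^~ y).
  move=> c z t; apply/lfunP => v.
  rewrite !(comp_lfunE, opp_lfunE, add_lfunE, scale_lfunE) linearP.
  by rewrite scalerBr opprD addrACA.
pose H := GRing.isLinear.Build _ _ _ _ _ lin.
pose g : {linear 'End(V) -> 'End(V)} := HB.pack (lie_bracket^~ y) H.
by rewrite -[LHS]/(g _) linear_sum; apply: eq_bigr => j _; rewrite linearZ.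
Qed.

Lemma lie_bracketC x y : lie_bracket x y = - lie_bracket y x.
Proof. by rewrite /lie_bracket opprB. Qed.

Lemma lie_bracket_sumr (J : finType) (a : J -> F) (u : J -> 'End(V)) x :
  lie_bracket x (\sum_j a j *: u j) = \sum_j a j *: lie_bracket x (u j).
Proof.
rewrite lie_bracketC lie_bracket_suml -sumrN; apply: eq_bigr => j _.
by rewrite -scalerN -lie_bracketC.
Qed.

Lemma lie_derivedP U W :
  (lie_derived U <= W)%VS <->
  (forall x y, x \in U -> y \in U -> lie_bracket x y \in W).
Proof.
split=> [/subvP sW x y Ux Uy | HW].
  rewrite (coord_vbasis Ux) lie_bracket_suml; apply: rpred_sum => i _.
  rewrite (coord_vbasis Uy) lie_bracket_sumr rpredZ //.
  apply: rpred_sum => j _; apply/rpredZ/sW/memv_span.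
  by apply: allpairs_f; rewrite -tnth_nth mem_tnth.
apply/span_subvP => _ /allpairsP[[x y] /= [Ux Uy ->]].
by apply: HW; apply: vbasis_mem.
Qed.

End LieSubalgebras.

Section BilinearForms.
Variables (F : fieldType) (V : vectType F) (f : {biscalar V}).
Implicit Types (x s : 'End(V)) (U W : {vspace V}) (c : F).

Definition skew_defect x : 'Hom(V, 'Hom(V, F^o)) :=
  linfun (fun v : V => linfun (fun w : V => f (x v) w + f v (x w) : F^o)).

(* L(f), as the kernel of x |-> ((v, w) |-> f (x v) w + f v (x w));           *)
(* see mem_lie_form.                                                          *)
Definition lie_form : {vspace 'End(V)} := lker (linfun skew_defect).

Lemma skew_defectE x v w : skew_defect x v w = f (x v) w + f v (x w).
Proof.
have lin1 u : linear (fun w : V => f (x u) w + f u (x w) : F^o).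
  by move=> a y z; rewrite !linearP scalerDr addrACA.
pose h1 u := linfun (fun w : V => f (x u) w + f u (x w) : F^o).
have h1E u z : h1 u z = f (x u) z + f u (x z).
  pose H := GRing.isLinear.Build _ _ _ _ _ (lin1 u).
  pose g : {linear V -> F^o} := HB.pack (fun w : V => _ : F^o) H.
  exact: (lfunE g z).
have lin2 : linear h1.
  move=> a y z; apply/lfunP => t.
  rewrite add_lfunE scale_lfunE !h1E !linearP !linearPl.
  by rewrite scalerDr addrACA.
pose H := GRing.isLinear.Build _ _ _ _ _ lin2.
pose g : {linear V -> 'Hom(V, F^o)} := HB.pack h1 H.
by rewrite -h1E; congr (fun_of_lfun _ w); exact: (lfunE g v).
Qed.

Lemma mem_lie_form x :
  x \in lie_form <-> forall v w, f (x v) w = - f v (x w).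
Proof.
have lin : linear skew_defect.
  move=> a y z; apply/lfunP => v; apply/lfunP => w.
  rewrite !(add_lfunE, scale_lfunE, skew_defectE) !linearP !linearPl.
  by rewrite scalerDr addrACA.
pose H := GRing.isLinear.Build _ _ _ _ _ lin.
pose g : {linear 'End(V) -> 'Hom(V, 'Hom(V, F^o))} := HB.pack skew_defect H.
rewrite memv_ker (lfunE g x) /=; split=> [/eqP x0 v w | xf].
  by apply/eqP; rewrite -addr_eq0 -skew_defectE x0 !zero_lfunE.
apply/eqP/lfunP => v; apply/lfunP => w.
by rewrite skew_defectE xf addNr !zero_lfunE.
Qed.

Lemma lie_form_bracket x y :
  x \in lie_form -> y \in lie_form -> lie_bracket x y \in lie_form.
Proof.
move=> /mem_lie_form fx /mem_lie_form fy; apply/mem_lie_form => v w.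
rewrite !(add_lfunE, opp_lfunE, comp_lfunE) linearBl linearB /=.
by rewrite !(fx, fy) !opprK opprB.
Qed.

Definition form_nondegenerate : Prop :=
  (forall v, (forall w, f v w = 0) -> v = 0) /\
  (forall w, (forall v, f v w = 0) -> w = 0).

Definition is_asymmetry s : Prop :=
  lker s = 0%VS /\ forall v w, f w v = f v (s w).

Definition form_symmetric_on U : Prop :=
  forall v w, v \in U -> w \in U -> f v w = f w v.

Definition form_skew_on U : Prop :=
  forall v w, v \in U -> w \in U -> f v w = - f w v.

Definition form_perp_sum U W : Prop :=
  [/\ (U + W)%VS = fullv, directv (U + W),
      (forall u w, u \in U -> w \in W -> f u w = 0)
    & (forall u w, u \in U -> w \in W -> f w u = 0)].

Lemma asymmetry_exists : form_nondegenerate -> exists s, is_asymmetry s.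
Proof.
move=> [ndl ndr].
pose hL v : 'Hom(V, F^o) := linfun (f v : V -> F^o).
pose hR v : 'Hom(V, F^o) := linfun (f^~ v : V -> F^o).
have hLE v w : hL v w = f v w.
  have lin : linear (f v : V -> F^o) by move=> a y z; rewrite linearP.
  pose H := GRing.isLinear.Build _ _ _ _ _ lin.
  pose g : {linear V -> F^o} := HB.pack (f v : V -> F^o) H.
  exact: (lfunE g w).
have hRE v w : hR v w = f w v.
  have lin : linear (f^~ v : V -> F^o) by move=> a y z; rewrite linearPl.
  pose H := GRing.isLinear.Build _ _ _ _ _ lin.
  pose g : {linear V -> F^o} := HB.pack (f^~ v : V -> F^o) H.
  exact: (lfunE g w).
have linL : linear hL.
  by move=> a y z; apply/lfunP => t; rewrite add_lfunE scale_lfunE !hLE linearPl.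
have linR : linear hR.
  by move=> a y z; apply/lfunP => t; rewrite add_lfunE scale_lfunE !hRE linearP.
pose HL := GRing.isLinear.Build _ _ _ _ _ linL.
pose gL : {linear V -> 'Hom(V, F^o)} := HB.pack hL HL.
pose HR := GRing.isLinear.Build _ _ _ _ _ linR.
pose gR : {linear V -> 'Hom(V, F^o)} := HB.pack hR HR.
have kR : lker (linfun gR) == 0%VS.
  apply/lker0P => v w; rewrite !lfunE => /= e; apply/eqP; rewrite -subr_eq0.
  apply/eqP/ndr => t; move/lfunP/(_ t): e; rewrite !hRE => e.
  by rewrite linearB /= e subrr.
have iR : limg (linfun gR) = fullv.
  apply/eqP; rewrite eqEdim subvf /= limg_dim_eq ?(eqP kR) ?capv0 //.
  by rewrite !dimvf /dim /= muln1.
have sE v w : f w v = f v (((linfun gR)^-1 \o linfun gL)%VF w).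
  rewrite comp_lfunE (lfunE gL) /=.
  have : gR ((linfun gR)^-1%VF (gL w)) = gL w.
    by rewrite -[LHS](lfunE gR) limg_lfunVK // iR memvf.
  by move/lfunP/(_ v) => /=; rewrite hRE hLE.
exists ((linfun gR)^-1 \o linfun gL)%VF; split=> //.
apply/eqP; rewrite -subv0; apply/subvP => w; rewrite memv_ker => /eqP sw.
by rewrite memv0; apply/eqP/ndl => v; rewrite sE sw linear0r.
Qed.

Lemma asymmetry_unique s t :
  form_nondegenerate -> is_asymmetry s -> is_asymmetry t -> s = t.
Proof.
move=> [_ ndr] [_ sE] [_ tE]; apply/lfunP => w; apply/eqP; rewrite -subr_eq0.
by apply/eqP/ndr => v; rewrite linearB /= -sE -tE subrr.
Qed.

End BilinearForms.

Section GeneralizedEigenspaces.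
Variables (F : fieldType) (V : vectType F).
Implicit Types (s : 'End(V)) (c : F).

(* As in mxpoly's geigenspace, the exponent dim V captures all exponents; see *)
(* mem_gen_eigenspace.                                                        *)
Definition gen_eigenspace s c : {vspace V} :=
  lker (iter (\dim {:V}) (comp_lfun (s - c *: \1)%VF) \1%VF).

Lemma iter_comp_lfunE s m v : iter m (comp_lfun s) \1%VF v = iter m s v.
Proof. by elim: m => [|m IH] /=; rewrite ?id_lfunE // comp_lfunE IH. Qed.

Lemma mem_gen_eigenspace s c v :
  v \in gen_eigenspace s c <->
  exists2 m, (0 < m)%N & iter m (s - c *: \1)%VF v = 0.
Proof.
rewrite memv_ker iter_comp_lfunE; set t := (s - _)%R; set n := \dim _.
split=> [/eqP nv | [m _ mv]].
  by exists n.+1; rewrite //= nv linear0.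
pose K k := lker (iter k (comp_lfun t) \1%VF).
have memK k u : (u \in K k) = (iter k t u == 0).
  by rewrite memv_ker iter_comp_lfunE.
have KS k : (K k <= K k.+1)%VS.
  by apply/subvP => u; rewrite !memK /= => /eqP->; rewrite linear0.
have stab k : K k = K k.+1 -> forall j, K (k + j)%N = K k.
  move=> e; elim=> [|j IH]; first by rewrite addn0.
  by apply/vspaceP => u; rewrite e !memK addnS !iterSr -!memK IH.
have [k [lekn ek]] : exists k, (k <= n)%N /\ K k = K k.+1.
  have H j : (j <= \dim (K j))%N \/ exists k, (k < j)%N /\ K k = K k.+1.
    elim: j => [|j [IH|[k [lt e]]]]; first by left.
    - have [e|ne] := eqVneq (K j) (K j.+1); first by right; exists j.
      left; apply: leq_ltn_trans IH _.
      by rewrite (ltn_leqif (dimv_leqif_eq (KS j))).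
    - by right; exists k; split=> //; apply: ltnW.
  have [lt|[k [lt e]]] := H n.+1; last by exists k.
  by have := leq_trans lt (dimvS (subvf _)); rewrite ltnn.
have : v \in K (k + m)%N by rewrite memK iterD mv; elim: {+}k => //= i /eqP->; rewrite linear0.
by rewrite stab // -(stab _ ek (n - k)%N) subnKC // memK.
Qed.

End GeneralizedEigenspaces.

(* Main.v *)
Require Import Defs.
From HB Require Import structures.
From mathcomp Require Import all_boot all_order all_algebra.
From mathcomp Require Import ring.
Import GRing.Theory.
Local Open Scope ring_scope.
Import passmx.

Set Implicit Arguments.
Unset Strict Implicit.
Unset Printing Implicit Defensive.

(**
Semisimplicity is tested on abelian ideals: the last nonzero term of the
derived series of a solvable ideal is an abelian ideal, because the terms of
that series are ideals by the Jacobi identity. The whole proof exhibits or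
excludes abelian ideals with explicit elements of L(f).

Suppose that L(f) is semisimple. In characteristic 2 the identity is a central
element of L(f), so the characteristic is not 2. If f is non-degenerate with
asymmetry s, then s - s^-1 lies in L(f) and commutes with L(f), so s^2 = 1; V is
then the sum of the eigenspaces of s for 1 and -1, which are orthogonal, with f
symmetric on the first and skew-symmetric on the second. If the first one has
dimension 2 and basis (u, v), the rotation w |-> f(u,w) v - f(v,w) u spans an
abelian ideal.

It remains to see that f is non-degenerate (semisimple_nondegenerate). Let A be
the Gram matrix, and M = A - t A^T over F[t].
- If det M <> 0, then the skew part A adj(M) - A^T adj(M)^T has its coefficients
  in L(f), and they commute with L(f), hence they vanish; the resulting identity
  A adj(M) = A^T adj(M)^T forces A to be invertible, because a vector of the
  kernel of A or of A^T is then killed by A, by A^T and so by M.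
- If det M = 0, the coefficients of a kernel vector of M form a chain
  c_0, ..., c_n with f(c_0, -) = 0, f(c_{i+1}, w) = f(w, c_i), f(-, c_n) = 0.
  Each chain gives an element x of L(f), w |-> sum_i f(c_{i+1}, w) (c_{i+1} - c_i).
  The vectors of chains span a totally isotropic L(f)-stable subspace C, and the
  elements of L(f) that map V to C and C to 0 form an abelian ideal that contains
  every such x, so x = 0. Then a nontrivial relation between the c_{i+1} - c_i
  shortens the chain, unless c_0 is in the radical of f; but the radical is zero
  too, since the maps from V to the radical that kill the radical form an abelian
  ideal.

Conversely, let x belong to an abelian ideal of L(f), so that [x,[x,y]] = 0 for
every y in L(f). With y = f(u,-) v - e f(v,-) u, for u and v both in the symmetric
part (e = 1) or both in the skew part (e = -1), this is an explicit identity.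
In the skew part, at u = v = w, it reads 4 f(xu,u) xu = 0; the symmetric form
f(xu,v) is therefore alternating, hence zero, and x = 0 there. In the symmetric
part it gives x^2 u = c u for every anisotropic u; if c <> 0 then u and xu are
independent, so the dimension is at least 3, and a nonzero v orthogonal to u and
xu leads to a contradiction. Hence x^2 = 0, and the same identity then gives
x = 0.
*)

(** * Abelian ideals of Lie algebras of endomorphisms *)

Section LieIdeals.
Variables (F : fieldType) (V : vectType F).
Implicit Types (x y z : 'End(V)) (L I U : {vspace 'End(V)}).

Lemma lie_bracketE x y v : lie_bracket x y v = x (y v) - y (x v).
Proof. by rewrite add_lfunE opp_lfunE !comp_lfunE. Qed.

Lemma lie_bracket_linear x : linear (lie_bracket x).
Proof.
move=> a y z; apply/lfunP => v.
rewrite !(lie_bracketE, add_lfunE, scale_lfunE) linearP.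
by rewrite scalerBr opprD addrACA.
Qed.

HB.instance Definition _ x := GRing.isLinear.Build F 'End(V) 'End(V) _
  (lie_bracket x) (lie_bracket_linear x).

Lemma lie_bracket_jacobi x y z :
  lie_bracket x (lie_bracket y z) =
  lie_bracket (lie_bracket x y) z + lie_bracket y (lie_bracket x z).
Proof.
have lB (g : 'End(V)) u w : g (u - w) = g u - g w by rewrite linearB.
apply/lfunP => v; rewrite add_lfunE !lie_bracketE !lB !opprB.
by rewrite [RHS]addrACA !subrKA addrACA [- x _ + _]addrC addrACA.
Qed.

Lemma lie_derived_ideal L I : lie_ideal L I -> lie_ideal L (lie_derived I).
Proof.
move=> [sIL idI]; split=> [|x y Lx].
  apply/lie_derivedP => x y Ix Iy; apply: (subvP sIL); apply: idI => //.
  exact: (subvP sIL).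
have adE u : linfun (lie_bracket x) u = lie_bracket x u by rewrite lfunE.
rewrite -adE memv_preim; apply/subvP: y; apply/lie_derivedP => y z Iy Iz.
have dI u v : u \in I -> v \in I -> lie_bracket u v \in lie_derived I.
  by move: u v; apply/lie_derivedP.
rewrite -memv_preim adE lie_bracket_jacobi; apply: rpredD; apply: dI => //;
  exact: idI.
Qed.

Lemma lie_derived_eq0 I :
  (forall x y, x \in I -> y \in I -> lie_bracket x y = 0) ->
  lie_derived I = 0%VS.
Proof.
move=> cI; apply/eqP; rewrite -subv0; apply/lie_derivedP => x y Ix Iy.
by rewrite cI // mem0v.
Qed.

(** The derived series of a nonzero solvable ideal ends with a nonzero abelian
    ideal of the whole algebra. *)
Lemma lie_semisimple_abelian_free L :
  (forall I, lie_ideal L I ->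
     (forall x y, x \in I -> y \in I -> lie_bracket x y = 0) -> I = 0%VS) ->
  lie_semisimple L.
Proof.
move=> noab I idI [n]; elim: n I idI => // n IHn I idI.
rewrite iterSr => /(IHn _ (lie_derived_ideal idI)) dI0; apply: noab => // x y.
have /lie_derivedP dI : (lie_derived I <= 0)%VS by rewrite dI0.
by move=> Ix Iy; apply/eqP; rewrite -memv0; apply: dI.
Qed.

(** The abelian ideals met below are described by properties that need not be
    decidable. A subspace satisfying P that is not yet an ideal is enlarged by a
    bracket, which stops for reasons of dimension; membership in a subspace is
    decidable, so this needs no excluded middle. *)
Lemma lie_semisimple_abelian_pred L (P : 'End(V) -> Prop) :
  lie_semisimple L ->
  (forall x, P x -> x \in L) ->
  (forall a x y, P x -> P y -> P (a *: x + y)) ->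
  (forall x y, x \in L -> P y -> P (lie_bracket x y)) ->
  (forall x y, P x -> P y -> lie_bracket x y = 0) ->
  forall x, P x -> x = 0.
Proof.
move=> ssL PL Plin Pbr Pab.
have idU U : (forall y, y \in U -> P y) ->
    (forall x y, x \in L -> y \in U -> lie_bracket x y \in U) -> U = 0%VS.
  move=> PU brU; apply: ssL; first by split=> //; apply/subvP => y /PU /PL.
  by exists 1%N; apply: lie_derived_eq0 => y z /PU Py /PU; apply: Pab.
have grow k U : (forall y, y \in U -> P y) -> (\dim {:'End(V)} <= \dim U + k)%N ->
    U = 0%VS.
  elim: k U => [|k IHk] U PU leU.
    have /eqP eU : U == fullv by rewrite eqEdim subvf -[\dim U]addn0.
    by apply: idU => // x y _ _; rewrite eU memvf.
  have [eU|neU] := eqVneq U 0%VS; first by [].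
  apply: idU => // x y Lx Uy; case Uxy: (lie_bracket x y \in U) => //.
  have /negP[] := neU; rewrite -subv0.
  suff <- : (U + <[lie_bracket x y]>)%VS = 0%VS by apply: addvSl.
  apply: IHk => [_ /memv_addP[u Uu [_ /vlineP[a ->] ->]]|].
    by rewrite addrC; apply: Plin; [apply: Pbr => //; apply: PU|apply: PU].
  apply: leq_trans leU _; rewrite addnS -addSn leq_add2r.
  rewrite (ltn_leqif (dimv_leqif_sup (addvSl _ _))).
  by apply/negP => /subvP/(_ _ (subvP (addvSr _ _) _ (memv_line _))); rewrite Uxy.
move=> x Px; apply/eqP; rewrite -memv0 -(@grow (\dim {:'End(V)}) <[x]>%VS).
- exact: memv_line.
- move=> _ /vlineP[a ->]; rewrite -[a *: x]addr0.
  have P0 : P 0 by rewrite -(addNr x) -scaleN1r; apply: Plin.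
  exact: Plin.
- exact: leq_addl.
Qed.

End LieIdeals.

(** * Elements of rank two and abelian ideals *)

Section FormElements.
Variables (F : fieldType) (V : vectType F) (f : {biscalar V}).
Implicit Types (x y z : 'End(V)) (u v w : V) (e : F).

Lemma lie_formE x v w : x \in lie_form f -> f (x v) w = - f v (x w).
Proof. by move/mem_lie_form. Qed.

Lemma form_dyad_linear u v : linear (fun w => f u w *: v).
Proof. by move=> a w z; rewrite linearP scalerDl scalerA. Qed.

(** Packed as a linear map at once, so that lfunE computes it. *)
Definition form_dyad u v : 'End(V) :=
  linfun (HB.pack (fun w => f u w *: v)
            (GRing.isLinear.Build _ _ _ _ _ (form_dyad_linear u v))
          : {linear V -> V}).

Lemma form_dyadE u v w : form_dyad u v w = f u w *: v.
Proof. by rewrite lfunE. Qed.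

(** For a non-degenerate form, the exterior square of V is identified with so(f)
    through u ^ v when e = 1, and its symmetric square with sp(f) through the
    product u v when e = -1. *)
Definition form_wedge e u v : 'End(V) := form_dyad u v - e *: form_dyad v u.

Lemma form_wedgeE e u v w :
  form_wedge e u v w = f u w *: v - (e * f v w) *: u.
Proof. by rewrite add_lfunE opp_lfunE scale_lfunE !form_dyadE scalerA. Qed.

Definition sign_vector e u := forall w, f u w = e * f w u.

Lemma sign_vector_stable e x u :
  x \in lie_form f -> sign_vector e u -> sign_vector e (x u).
Proof.
by move=> Lx su w; rewrite lie_formE // su (lie_formE _ _ Lx) mulrN opprK.
Qed.

Lemma mem_form_wedge e u v :
  e * e = 1 -> sign_vector e u -> sign_vector e v -> form_wedge e u v \in lie_form f.
Proof.
move=> e2 su sv; apply/mem_lie_form => w z.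
rewrite !form_wedgeE linearBl linearBr /= !linearZl_LR !linearZr_LR /=.
rewrite (su w) (sv w).
ring: e2.
Qed.

(** L(f) acts on these elements by derivations in u and v. *)
Lemma bracket_form_wedge e x u v : x \in lie_form f ->
  lie_bracket x (form_wedge e u v) = form_wedge e (x u) v + form_wedge e u (x v).
Proof.
move=> Lx; apply/lfunP => w.
rewrite add_lfunE lie_bracketE !form_wedgeE [x (_ - _)]linearB /= !linearZ /=.
rewrite !(lie_formE _ _ Lx) mulrN !scaleNr opprD addrACA [RHS]addrACA.
by congr (_ + _); rewrite addrC.
Qed.

Lemma double_bracket_form_wedge e x u v w : x \in lie_form f ->
  lie_bracket x (lie_bracket x (form_wedge e u v)) = 0 ->
  f (x (x u)) w *: v - (e * f v w) *: x (x u)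
  + (f (x u) w *: x v - (e * f (x v) w) *: x u) *+ 2
  + (f u w *: x (x v) - (e * f (x (x v)) w) *: u) = 0.
Proof.
move=> Lx; rewrite bracket_form_wedge // linearD /= !bracket_form_wedge //.
move/lfunP/(_ w); rewrite 3!add_lfunE !form_wedgeE zero_lfunE => <-.
by rewrite mulr2n !addrA.
Qed.

Definition nondegenerate_on (U : {vspace V}) :=
  forall u, u \in U -> (forall v, v \in U -> f u v = 0) -> u = 0.

(** The identity of double_bracket_form_wedge at u = v = w = a, where f(a,a) = 0
    and f(x(xa),a) = 0, reduces to 4 f(xa,a) xa = 0. Hence f(xa,a) = 0 for all a,
    and f(xa,b) is symmetric in a and b. *)
Lemma lie_form_skew_rigid x (U : {vspace V}) :
  2%:R != 0 :> F -> nondegenerate_on U ->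
  (forall u, u \in U -> sign_vector (-1) u) ->
  x \in lie_form f -> (forall u, u \in U -> x u \in U) ->
  (forall u v, u \in U -> v \in U ->
     lie_bracket x (lie_bracket x (form_wedge (-1) u v)) = 0) ->
  forall u, u \in U -> x u = 0.
Proof.
move=> n2 ndU sU Lx xU xx u Uu.
have dbl (a : F) : a = - a -> a = 0.
  move=> /eqP; rewrite -subr_eq0 opprK -mulr2n -mulr_natl mulf_eq0 (negPf n2).
  by move/eqP.
have sgn a b : a \in U -> f a b = - f b a by move=> Ua; rewrite sU // mulN1r.
have symx a b : a \in U -> f (x a) b = f (x b) a.
  by move=> Ua; rewrite lie_formE // sgn // opprK.
have alt a : a \in U -> f (x a) a = 0.
  move=> Ua; have := double_bracket_form_wedge a Lx (xx _ _ Ua Ua).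
  have -> : f a a = 0 by apply: dbl; apply: sgn.
  have -> : f (x (x a)) a = 0.
    by rewrite lie_formE // [f (x a) _]dbl ?oppr0 //; apply: sgn; apply: xU.
  rewrite !(mulr0, mul0r, scale0r, subr0, add0r, addr0, oppr0) mulN1r scaleNr opprK.
  rewrite -mulr2n -mulrnA -scaler_nat => /eqP.
  rewrite !scaler_eq0 (natrM _ 2 2) mulf_eq0 (negPf n2) /=.
  by case/orP=> /eqP // ->; rewrite linear0l.
apply: ndU => [|v Uv]; first exact: xU.
have := alt _ (rpredD Uu Uv).
rewrite [x _]linearD linearDl !linearDr /= !alt // add0r addr0 (symx v) //.
by move/eqP; rewrite addr_eq0 => /eqP/dbl.
Qed.

(** If u is isotropic and f(u,v) <> 0, then at most one of v, v + u and v - u is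
    isotropic; over any field with 2 <> 0, two anisotropic ones among them span
    a space that contains u. *)
Lemma sub_of_anisotropic (U K : {vspace V}) :
  2%:R != 0 :> F -> nondegenerate_on U ->
  (forall u v, u \in U -> f u v = f v u) ->
  (forall u, u \in U -> f u u != 0 -> u \in K) -> (U <= K)%VS.
Proof.
move=> n2 ndU symU UK; apply/subvP => u Uu; case Ku: (u \in K) => //.
suff u0 : u = 0 by rewrite u0 mem0v in Ku.
apply: ndU => // v Uv; apply/eqP/negPn/negP => uv.
have qu : f u u = 0 by apply/eqP/negPn/negP => /(UK _ Uu); rewrite Ku.
have iso w : w \in U -> w \notin K -> f w w = 0.
  by move=> Uw Kw; apply/eqP/negPn/negP => /(UK _ Uw); rewrite (negPf Kw).
have qD : f (v + u) (v + u) = f v v + 2%:R * f u v.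
  by rewrite linearDl !linearDr /= qu (symU v) //; ring.
have qB : f (v - u) (v - u) = f v v - 2%:R * f u v.
  by rewrite linearBl !linearBr /= qu (symU v) //; ring.
have b0 : 2%:R * f u v != 0 by rewrite mulf_neq0.
have n2K w : (2%:R *: w \in K) = (w \in K) by rewrite rpredZeq (negPf n2).
have [Kv|Kv] := boolP (v \in K).
  have eD : f (v + u) (v + u) = 0.
    by apply: iso; [apply: rpredD | rewrite rpredDl ?Ku].
  have eB : f (v - u) (v - u) = 0.
    by apply: iso; [apply: rpredB | rewrite rpredBl ?Ku].
  have /eqP : 2%:R * (2%:R * f u v) = 0.
    by rewrite -[RHS](subrr 0) -{1}eD -eB qD qB; ring.
  by rewrite mulf_eq0 (negPf n2) (negPf b0).
have qv := iso _ Uv Kv.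
have KD : v + u \in K.
  by apply: UK; rewrite ?rpredD // qD qv add0r.
have KB : v - u \in K.
  by apply: UK; rewrite ?rpredB // qB qv add0r oppr_eq0.
suff : u \in K by rewrite Ku.
by have := rpredB KD KB; rewrite opprB addrC subrKA -mulr2n -scaler_nat n2K.
Qed.

Lemma dim_cap_lker_functional (g : 'Hom(V, F^o)) (U : {vspace V}) :
  (\dim U <= (\dim (U :&: lker g)).+1)%N.
Proof.
rewrite -(limg_ker_dim g U) -addn1 leq_add2l.
by apply: leq_trans (dimvS (subvf _)) _; rewrite dimvf.
Qed.

(** Two linear conditions cut the dimension by at most 2. *)
Lemma exists_perp_pair (U : {vspace V}) u1 u2 : (2 < \dim U)%N ->
  exists v, [/\ v \in U, v != 0, f v u1 = 0 & f v u2 = 0].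
Proof.
move=> dU.
have lin u : linear (f^~ u : V -> F^o) by move=> a y z; rewrite linearPl.
pose g u : 'Hom(V, F^o) := linfun (HB.pack (f^~ u : V -> F^o)
  (GRing.isLinear.Build _ _ _ _ _ (lin u)) : {linear V -> F^o}).
have gE u v : g u v = f v u by rewrite lfunE.
pose W := (U :&: lker (g u1) :&: lker (g u2))%VS.
have : W != 0%VS.
  apply: contraTneq dU => W0; rewrite -leqNgt.
  apply: leq_trans (dim_cap_lker_functional (g u1) U) _; rewrite ltnS.
  apply: leq_trans (dim_cap_lker_functional (g u2) _) _.
  by rewrite -/W W0 dimv0.
rewrite -vpick0; move: (memv_pick W) => + v0.
rewrite !memv_cap !memv_ker !gE => /andP[/andP[Uv /eqP v1] /eqP v2].
by exists (vpick W).
Qed.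

(** Here T is the identity [x,[x,u^v]] = 0 evaluated at w. For anisotropic u it
    first yields x(xu) = c u (sq), then c = 0 (sq0), hence x^2 = 0 on U (sqU).
    The claim is false in dimension 2, where x may be a rotation with
    x^2 = c <> 0; the hypothesis on the dimension enters through the choice of a
    vector v of U orthogonal to u and xu. *)
Lemma lie_form_sym_rigid x (U : {vspace V}) :
  2%:R != 0 :> F -> nondegenerate_on U -> \dim U <> 2%N ->
  (forall u, u \in U -> sign_vector 1 u) ->
  x \in lie_form f -> (forall u, u \in U -> x u \in U) ->
  (forall u v, u \in U -> v \in U ->
     lie_bracket x (lie_bracket x (form_wedge 1 u v)) = 0) ->
  forall u, u \in U -> x u = 0.
Proof.
move=> n2 ndU dU sU Lx xU xx.
have sym a b : a \in U -> f a b = f b a by move=> Ua; rewrite sU // mul1r.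
have adj a b : f (x a) b = - f a (x b) by apply: lie_formE.
have alt a : a \in U -> f (x a) a = 0.
  move=> Ua; apply/eqP; have /eqP : 2%:R * f (x a) a = 0.
    have := adj a a; rewrite (sym a) ?xU // => e.
    by rewrite mulr_natl mulr2n {1}e addNr.
  by rewrite mulf_eq0 (negPf n2).
have adj2 a b : f (x (x a)) b = f a (x (x b)) by rewrite !adj opprK.
have T u v w : u \in U -> v \in U ->
    f (x (x u)) w *: v - f v w *: x (x u)
    + 2%:R *: (f (x u) w *: x v - f (x v) w *: x u)
    + (f u w *: x (x v) - f (x (x v)) w *: u) = 0.
  move=> Uu Uv; have := double_bracket_form_wedge w Lx (xx _ _ Uu Uv).
  by rewrite !mul1r scaler_nat.
have lZ (a : F) v w : f (a *: v) w = a * f v w by rewrite linearZl_LR.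
have sq u : u \in U -> f u u != 0 -> x (x u) = (f (x (x u)) u / f u u) *: u.
  move=> Uu q0; set r := f (x (x u)) u.
  (* T at (u, xu, u). *)
  have x3 : f u u *: x (x (x u)) = r *: x u.
    have := T u (x u) u Uu (xU _ Uu); rewrite -/r.
    have -> : f (x (x (x u))) u = 0 by rewrite adj2 sym ?alt ?xU.
    rewrite alt // !scale0r !(subr0, add0r) scalerN scaler_nat mulr2n => /eqP.
    by rewrite opprD addrA subrr sub0r addrC subr_eq0 => /eqP.
  (* t is killed by x and orthogonal to u. If t <> 0, then T at (t, v, u) shows
     that x(xu) is orthogonal to U, so t = - r u with r = 0. *)
  pose t := f u u *: x (x u) - r *: u.
  have Ut : t \in U by rewrite rpredB // rpredZ // !xU.
  have xt : x t = 0.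
    rewrite /t linearB /= [x (_ *: x (x u))]linearZ [x (r *: u)]linearZ /=.
    by rewrite x3 subrr.
  have tu : f t u = 0 by rewrite linearBl /= !lZ mulrC subrr.
  have [t0|nt0] := eqVneq t 0.
    apply: (scalerI q0); rewrite scalerA mulrC divfK //.
    by apply/eqP; rewrite -subr_eq0 -/t t0.
  have xxu : x (x u) = 0.
    apply: ndU => [|v Uv]; first by rewrite !xU.
    rewrite adj2 sym //; have := T t v u Ut Uv.
    rewrite xt linear0 !linear0l tu !(scale0r, scaler0, oppr0, subr0, add0r).
    by move/eqP; rewrite oppr_eq0 scaler_eq0 (negPf nt0) orbF => /eqP.
  by rewrite /r xxu linear0l mul0r scale0r.
have sq0 u : u \in U -> f u u != 0 -> x (x u) = 0.
  move=> Uu q0; have xxu := sq _ Uu q0; rewrite xxu.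
  set c := f _ _ / _ in xxu *; have [->|c0] := eqVneq c 0; first exact: scale0r.
  (* xu is nonzero and orthogonal to u, so dim U > 1. *)
  have xu0 : x u != 0.
    apply: contraNneq c0 => xu; have /eqP := xxu.
    rewrite xu linear0 eq_sym scaler_eq0 => /orP[//|/eqP u0].
    by rewrite u0 linear0l eqxx in q0.
  have dU2 : (2 < \dim U)%N.
    rewrite ltn_neqAle eq_sym; apply/andP; split; first exact/eqP.
    apply: (@leq_trans (\dim (<[u]> + <[x u]>))); last first.
      by apply/dimvS; rewrite subv_add -!memvE Uu xU.
    have u0 : u != 0 by apply: contraNneq xu0 => ->; rewrite linear0.
    rewrite (_ : 2 = (\dim <[u]>).+1)%N; last by rewrite dim_vline u0.
    rewrite (ltn_leqif (dimv_leqif_sup (addvSl _ _))) subv_add subvv /= -memvE.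
    apply: contra xu0 => /vlineP[a xuE]; have /eqP := alt _ Uu.
    by rewrite xuE lZ mulf_eq0 (negPf q0) orbF => /eqP->; rewrite scale0r.
  have [v [Uv v0 vu vxu]] := exists_perp_pair u (x u) dU2.
  have xvu : f (x v) u = 0 by rewrite adj vxu oppr0.
  have xxvu : f (x (x v)) u = 0 by rewrite adj2 xxu linearZ /= vu mulr0.
  (* T at (u, v, xu), with f(xu,xu) = - c f(u,u) <> 0. *)
  have xv : x v = 0.
    have := T u v (x u) Uu Uv.
    rewrite alt ?xU // vxu.
    have -> : f (x v) (x u) = 0 by rewrite adj xxu linearZ /= vu mulr0 oppr0.
    have -> : f u (x u) = 0 by rewrite sym // alt.
    have -> : f (x (x v)) (x u) = 0.
      by rewrite adj2 xxu linearZ /= linearZ /= vxu mulr0.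
    rewrite !scale0r !(subr0, add0r, addr0) => /eqP.
    rewrite !scaler_eq0 (negPf n2) adj xxu linearZ /= oppr_eq0 mulf_eq0.
    by rewrite (negPf q0) (negPf c0) => /eqP.
  (* T at (u, v, u) now reads c f(u,u) v = 0. *)
  have := T u v u Uu Uv; rewrite vu alt // xvu xv [x 0]linear0 [f 0 u]linear0l.
  rewrite !(scale0r, scaler0, oppr0, subr0, addr0) => /eqP.
  by rewrite scaler_eq0 (negPf v0) orbF xxu lZ mulf_eq0 (negPf c0) (negPf q0).
have sqU u : u \in U -> x (x u) = 0.
  have /subvP kxx : (U <= lker (x \o x))%VS.
    apply: sub_of_anisotropic => // a Ua qa.
    by rewrite memv_ker comp_lfunE sq0.
  by move=> /kxx; rewrite memv_ker comp_lfunE => /eqP.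
(* T at (u, v, u) is now 2 f(xv,u) xu = 0, and f(xv,u) = - f(v,xu). *)
move=> u Uu; apply/eqP; case xu0: (x u == 0) => //; rewrite -xu0; apply/eqP.
apply: ndU => [|v Uv]; first exact: xU.
rewrite sym ?xU //; apply/eqP; rewrite -oppr_eq0 -adj.
have := T u v u Uu Uv; rewrite !sqU // alt // !linear0l.
rewrite !(scale0r, scaler0, oppr0, subr0, add0r, addr0) => /eqP.
by rewrite scaler_eq0 (negPf n2) /= oppr_eq0 scaler_eq0 xu0 orbF.
Qed.

End FormElements.

(** * Non-degenerate forms *)

Section NonDegenerateForms.
Variables (F : fieldType) (V : vectType F) (f : {biscalar V}).
Implicit Types (x y z s : 'End(V)) (u v w : V) (e : F) (U W : {vspace V}).

Lemma sign_vector_eq0 u : 2%:R != 0 :> F -> form_nondegenerate f ->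
  sign_vector f 1 u -> sign_vector f (-1) u -> u = 0.
Proof.
move=> n2 [ndl _] pu mu; apply: ndl => w; apply/eqP.
have /eqP : 2%:R * f u w = 0 by rewrite mulr_natl mulr2n {1}pu mu; ring.
by rewrite mulf_eq0 (negPf n2).
Qed.

Lemma sign_vectorD e u v :
  sign_vector f e u -> sign_vector f e v -> sign_vector f e (u + v).
Proof. by move=> su sv w; rewrite linearDl linearDr /= su sv mulrDr. Qed.

Lemma sign_vectorN e u : sign_vector f e u -> sign_vector f e (- u).
Proof. by move=> su w; rewrite linearNl linearNr /= su mulrN. Qed.

(** The two summands are the spaces of vectors u such that f(u,w) = f(w,u),
    respectively f(u,w) = - f(w,u), for all w of V. As L(f) preserves these
    conditions, it preserves the summands, and an element of an abelian ideal is
    zero on each of them. *)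
Lemma perp_sum_semisimple U W : 2%:R != 0 :> F -> form_nondegenerate f ->
  form_perp_sum f U W -> form_symmetric_on f U -> \dim U <> 2%N ->
  form_skew_on f W -> lie_semisimple (lie_form f).
Proof.
move=> n2 nd [UW _ fUW fWU] symU dU skewW; have [ndl _] := nd.
have dec w : exists2 a, a \in U & exists2 b, b \in W & w = a + b.
  by apply/memv_addP; rewrite UW memvf.
have sU u : u \in U -> sign_vector f 1 u.
  move=> Uu w; have [a Ua [b Wb ->]] := dec w.
  by rewrite linearDl linearDr /= (fUW u b) // (fWU u b) // !addr0 mul1r symU.
have sW u : u \in W -> sign_vector f (-1) u.
  move=> Wu w; have [a Ua [b Wb ->]] := dec w.
  by rewrite linearDl linearDr /= (fUW a u) // (fWU a u) // !add0r mulN1r skewW.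
have inU u : sign_vector f 1 u -> u \in U.
  move=> su; have [a Ua [b Wb uE]] := dec u; rewrite uE.
  suff -> : b = 0 by rewrite addr0.
  apply: sign_vector_eq0 => //; last exact: sW.
  by rewrite -(addKr a b) -uE; apply: sign_vectorD => //; apply/sign_vectorN/sU.
have inW u : sign_vector f (-1) u -> u \in W.
  move=> su; have [a Ua [b Wb uE]] := dec u; rewrite uE.
  suff -> : a = 0 by rewrite add0r.
  apply: sign_vector_eq0 => //; first exact: sU.
  by rewrite -(addrK b a) -uE; apply: sign_vectorD => //; apply/sign_vectorN/sW.
have ndU : nondegenerate_on f U.
  move=> u Uu u0; apply: ndl => w; have [a Ua [b Wb ->]] := dec w.
  by rewrite linearDr /= u0 // (fUW u b) // addr0.
have ndW : nondegenerate_on f W.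
  move=> u Uu u0; apply: ndl => w; have [a Ua [b Wb ->]] := dec w.
  by rewrite linearDr /= (u0 b) // (fWU a u) // addr0.
apply: lie_semisimple_abelian_free => I [/subvP sIL idI] abI.
apply/eqP; rewrite -subv0; apply/subvP => x Ix; rewrite memv0.
have Lx := sIL x Ix.
have xx y : y \in lie_form f -> lie_bracket x (lie_bracket x y) = 0.
  by move=> Ly; apply: abI => //; rewrite lie_bracketC rpredN; apply: idI.
have xU u : u \in U -> x u = 0.
  apply: (lie_form_sym_rigid n2 ndU dU sU Lx) => [v /sU|a b /sU sa /sU sb].
    by move/(sign_vector_stable Lx)/inU.
  by apply: xx; apply: mem_form_wedge; rewrite ?mulr1.
have xW u : u \in W -> x u = 0.
  apply: (lie_form_skew_rigid n2 ndW sW Lx) => [v /sW|a b /sW sa /sW sb].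
    by move/(sign_vector_stable Lx)/inW.
  by apply: xx; apply: mem_form_wedge; rewrite ?mulrNN ?mulr1.
apply/eqP/lfunP => w; rewrite zero_lfunE; have [a Ua [b Wb ->]] := dec w.
by rewrite linearD /= xU // xW // addr0.
Qed.

Lemma lie_form_central_eq0 z : lie_semisimple (lie_form f) ->
  z \in lie_form f -> (forall x, x \in lie_form f -> lie_bracket x z = 0) -> z = 0.
Proof.
move=> ss Lz cz.
apply: (@lie_semisimple_abelian_pred _ _ _ (fun y => y \in lie_form f /\
   forall x, x \in lie_form f -> lie_bracket x y = 0) ss) => //.
- by move=> x [].
- move=> a x y [Lx cx] [Ly cy]; split=> [|t Lt]; first by rewrite rpredD ?rpredZ.
  by rewrite linearP /= cx // cy // scaler0 addr0.
- by move=> x y Lx [Ly cy]; rewrite cy //; split=> [|t _]; rewrite ?mem0v ?linear0.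
- by move=> x y [Lx _] [_ cy]; apply: cy.
Qed.

Lemma semisimple_char_neq2 : (0 < \dim {:V})%N ->
  lie_semisimple (lie_form f) -> 2%:R != 0 :> F.
Proof.
move=> hV ss; apply/negP => /eqP two0.
have opp (a : F) : - a = a.
  by apply/eqP; rewrite eq_sym -subr_eq0 opprK -mulr2n -mulr_natl two0 mul0r.
have id0 : \1%VF = 0 :> 'End(V).
  apply: lie_form_central_eq0 ss _ _ => [|x _].
    by apply/mem_lie_form => v w; rewrite !id_lfunE opp.
  by rewrite /lie_bracket comp_lfun1l comp_lfun1r subrr.
have : vpick {:V} != 0 by rewrite vpick0 -dimv_eq0 -lt0n.
by rewrite -[vpick _]id_lfunE id0 zero_lfunE eqxx.
Qed.

(** The asymmetry is an isometry that commutes with L(f), so s - s^-1 is a central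
    element of L(f). *)
Lemma semisimple_asymmetry_involutive s : form_nondegenerate f ->
  lie_semisimple (lie_form f) -> is_asymmetry f s -> forall v, s (s v) = v.
Proof.
move=> [ndl ndr] ss [ks sE].
have kers : lker s == 0%VS by apply/eqP.
have fss v w : f (s v) (s w) = f v w by rewrite -sE -sE.
have fVs v w : f (s^-1%VF v) w = f v (s w).
  by rewrite -fss lker0_lfunVK.
have sC x v : x \in lie_form f -> s (x v) = x (s v).
  move=> Lx; apply/eqP; rewrite -subr_eq0; apply/eqP/ndr => w.
  rewrite linearB /= -sE (lie_formE _ _ Lx) -[f w _]opprK.
  by rewrite -(lie_formE w (s v) Lx) -sE opprK addNr.
have sVC x v : x \in lie_form f -> s^-1%VF (x v) = x (s^-1%VF v).
  by move=> Lx; rewrite -[v in LHS](lker0_lfunVK kers) -sC // lker0_lfunK.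
have z0 : s - s^-1%VF = 0.
  apply: lie_form_central_eq0 ss _ _ => [|x Lx].
    apply/mem_lie_form => v w; rewrite !(add_lfunE, opp_lfunE) linearBl linearB /=.
    by rewrite fVs -(fss v (s^-1%VF w)) lker0_lfunVK // opprB.
  apply/lfunP => v; rewrite lie_bracketE !(add_lfunE, opp_lfunE) linearB /=.
  by rewrite sC // sVC // subrr zero_lfunE.
move=> v; have /lfunP/(_ v) := z0.
rewrite add_lfunE opp_lfunE zero_lfunE => /subr0_eq ->.
by rewrite lker0_lfunVK.
Qed.

(** With t = s - e, the relation t^2 = -2 e t makes the eigenvalue e semisimple. *)
Lemma gen_eigenspace_involution s e v : 2%:R != 0 :> F -> e * e = 1 ->
  (forall w, s (s w) = w) -> (v \in gen_eigenspace s e) = (s v == e *: v).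
Proof.
move=> n2 e2 ss; set t := s - e *: \1%VF.
have e0 : e != 0 by apply: contra_eqN e2 => /eqP->; rewrite mul0r eq_sym oner_eq0.
have tE w : t w = s w - e *: w by rewrite !(add_lfunE, opp_lfunE, scale_lfunE) id_lfunE.
have tt w : t (t w) = (- 2%:R * e) *: t w.
  rewrite !tE linearB /= linearZ /= ss !scalerBr !scalerA.
  rewrite e2 -mulrA e2 scale1r mulr1 opprB mulNr !scaleNr opprK.
  by rewrite -scalerA !scaler_nat -[LHS]mulr2n mulrnBl addrC.
apply/idP/eqP => [/mem_gen_eigenspace[[//|m] _]|sv]; last first.
  by apply/mem_gen_eigenspace; exists 1%N => //=; rewrite -/t tE sv subrr.
have itE k : iter k.+1 t v = (- 2%:R * e) ^+ k *: t v.
  elim: k => [|k IHk]; first by rewrite scale1r.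
  by rewrite iterS IHk linearZ /= tt scalerA exprSr.
rewrite itE => /eqP; rewrite scaler_eq0 expf_eq0 mulf_eq0 oppr_eq0.
by rewrite (negPf n2) (negPf e0) andbF tE subr_eq0 => /eqP.
Qed.

(** Bracketing with x multiplies the rotation of the plane spanned by u and v by
    the trace of x on that plane, so this rotation spans an abelian ideal. *)
Lemma semisimple_dim_neq2 U : (forall u, u \in U <-> sign_vector f 1 u) ->
  form_nondegenerate f -> lie_semisimple (lie_form f) -> \dim U <> 2%N.
Proof.
move=> UE [ndl _] ss dU.
have [u [v [fuv UuvE]]] : exists u v, free [:: u; v] /\ U = <<[:: u; v]>>%VS.
  have /andP[/eqP spU frU] := vbasisP U; have := etrans (size_tuple (vbasis U)) dU.
  case: (val (vbasis U)) spU frU => [|u [|v [|]]] // spU frU _.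
  by exists u, v.
have [Uu Uv] : u \in U /\ v \in U by rewrite UuvE !memv_span ?inE ?eqxx ?orbT.
have [su sv] : sign_vector f 1 u /\ sign_vector f 1 v by split; apply/UE.
have Lz : form_wedge f 1 u v \in lie_form f by apply: mem_form_wedge; rewrite ?mulr1.
have br x : x \in lie_form f ->
    exists a, lie_bracket x (form_wedge f 1 u v) = a *: form_wedge f 1 u v.
  move=> Lx; have xU w : w \in U -> exists a b, x w = a *: u + b *: v.
    move=> /UE/(sign_vector_stable Lx)/UE; rewrite UuvE span_cons span_seq1.
    by case/memv_addP => _ /vlineP[a ->] [_ /vlineP[b ->] ->]; exists a, b.
  have [[a [b xu]] [c [d xv]]] := (xU _ Uu, xU _ Uv).
  exists (a + d); rewrite bracket_form_wedge // xu xv; apply/lfunP => w.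
  rewrite add_lfunE scale_lfunE !form_wedgeE !mul1r !linearDl !linearZl_LR /=.
  (* Pairing with an arbitrary z turns a vector identity into a scalar one. *)
  apply/subr0_eq/ndl => z.
  by rewrite !(linearDl, linearBl, linearNl, linearZl_LR) /=; ring.
have : form_wedge f 1 u v = 0.
  apply: (@lie_semisimple_abelian_pred _ _ _
            (fun y => exists a, y = a *: form_wedge f 1 u v) ss).
  - by move=> _ [a ->]; apply: rpredZ.
  - by move=> a _ _ [b ->] [c ->]; exists (a * b + c); rewrite scalerDl scalerA.
  - move=> x _ Lx [a ->]; have [b xb] := br x Lx.
    by exists (a * b); rewrite linearZ /= xb scalerA.
  - move=> _ _ [a ->] [b ->]; rewrite linearZ /= lie_bracketC linearZ /=.
    by rewrite /lie_bracket subrr scaler0 oppr0 scaler0.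
  - by exists 1; rewrite scale1r.
move=> z0; move: fuv; rewrite free_cons seq1_free => /andP[/negP uv /eqP[]].
apply: ndl => w; apply/eqP/negPn/negP => vw; case: uv.
have /lfunP/(_ w) := z0; rewrite form_wedgeE zero_lfunE mul1r => /subr0_eq e.
rewrite span_seq1 -[u](scalerK vw) -e scalerA.
by rewrite rpredZ ?memv_line.
Qed.

Lemma semisimple_nondegenerate_split : 2%:R != 0 :> F ->
  form_nondegenerate f -> lie_semisimple (lie_form f) ->
  exists s : 'End(V),
    let V1 := gen_eigenspace s 1 in
    let Vm1 := gen_eigenspace s (-1) in
    is_asymmetry f s /\
    [/\ form_perp_sum f V1 Vm1, form_symmetric_on f V1,
        \dim V1 <> 2%N & form_skew_on f Vm1].
Proof.
move=> n2 nd ss; have [s sA] := asymmetry_exists nd; exists s => V1 Vm1.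
have sK := semisimple_asymmetry_involutive nd ss sA; have [_ sE] := sA.
have eigE e u : e * e = 1 -> u \in gen_eigenspace s e <-> sign_vector f e u.
  move=> e2; rewrite gen_eigenspace_involution //; split=> [/eqP su w|su].
    by rewrite [f u w]sE su linearZr_LR.
  have [_ ndr] := nd; rewrite -subr_eq0; apply/eqP/ndr => w.
  by rewrite linearBr linearZr_LR /= -sE su subrr.
have inV1 u : u \in V1 <-> sign_vector f 1 u by apply: eigE; rewrite mulr1.
have inVm1 u : u \in Vm1 <-> sign_vector f (-1) u.
  by apply: eigE; rewrite mulrNN mulr1.
have ev1 u : (u \in V1) = (s u == 1 *: u).
  by rewrite gen_eigenspace_involution ?mulr1.
have evm1 u : (u \in Vm1) = (s u == - 1 *: u).
  by rewrite gen_eigenspace_involution ?mulrNN ?mulr1.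
have perp u w : u \in V1 -> w \in Vm1 -> f u w = 0.
  move=> /inV1 su /inVm1 sw; apply/eqP.
  have /eqP : 2%:R * f u w = 0 by rewrite mulr_natl mulr2n {1}su mul1r sw; ring.
  by rewrite mulf_eq0 (negPf n2).
split=> //; split; first split.
- apply/eqP; rewrite eqEsubv subvf /=; apply/subvP => v _.
  have -> : v = 2%:R^-1 *: (v + s v) + 2%:R^-1 *: (v - s v).
    by rewrite -scalerDr addrACA subrr addr0 -mulr2n -scaler_nat scalerK.
  apply: memv_add; apply: rpredZ.
    by rewrite ev1 linearD /= sK scale1r addrC.
  by rewrite evm1 linearB /= sK scaleN1r opprB.
- apply/directv_addP/eqP; rewrite -subv0; apply/subvP => v.
  rewrite memv_cap memv0 => /andP[/inV1 v1 /inVm1 vm1].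
  by apply/eqP/(sign_vector_eq0 n2 nd).
- exact: perp.
- by move=> u w u1 wm1; have /inV1 := u1; move/(_ w); rewrite perp // mul1r.
- by move=> u w /inV1 su _; rewrite su mul1r.
- exact: semisimple_dim_neq2.
- by move=> u w /inVm1 su _; rewrite su mulN1r.
Qed.

End NonDegenerateForms.

(** * Chains of a degenerate form *)

Section DegenerateForms.
Variables (F : fieldType) (V : vectType F) (f : {biscalar V}).
Implicit Types (x y z : 'End(V)) (u v w r : V) (c : nat -> V).

Definition in_radical r := forall w, f r w = 0 /\ f w r = 0.

(** The maps from V to the radical that kill the radical form an abelian ideal of
    L(f), which contains w |-> f(u,w) r for every r in the radical. If f = 0, the
    identity is central in L(f) instead. *)
Lemma semisimple_radical0 r : (0 < \dim {:V})%N ->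
  lie_semisimple (lie_form f) -> in_radical r -> r = 0.
Proof.
move=> hV ss Rr; apply/eqP/negPn/negP => r0.
pose P y := (forall w, in_radical (y w)) /\ (forall q, in_radical q -> y q = 0).
have P0 : forall y, P y -> y = 0.
  apply: (lie_semisimple_abelian_pred ss).
  - move=> y [Ry _]; apply/mem_lie_form => v w.
    by have [-> _] := Ry v w; have [_ ->] := Ry w v; rewrite oppr0.
  - move=> a y z [Ry y0] [Rz z0]; split=> [w t|q Rq]; last first.
      by rewrite add_lfunE scale_lfunE y0 // z0 // scaler0 addr0.
    rewrite add_lfunE scale_lfunE linearPl linearPr /=.
    by have [-> ->] := Ry w t; have [-> ->] := Rz w t; rewrite !mulr0 !addr0.
  - move=> y z Ly [Rz z0].
    have Ryq q : in_radical q -> in_radical (y q).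
      move=> Rq w; rewrite lie_formE // -[f w _]opprK -(lie_formE w q Ly).
      by have [-> _] := Rq (y w); have [_ ->] := Rq (y w); rewrite oppr0.
    split=> [w t|q Rq]; last first.
      by rewrite lie_bracketE (z0 q) // (z0 (y q)) ?subr0 ?linear0 //; apply: Ryq.
    rewrite lie_bracketE linearBl linearBr /=.
    by have [-> ->] := Ryq _ (Rz w) t; have [-> ->] := Rz (y w) t; rewrite !subr0.
  - move=> y z [Ry y0] [Rz z0]; apply/lfunP => w.
    by rewrite lie_bracketE y0 // z0 // subrr zero_lfunE.
have f0 u w : f u w = 0.
  have /lfunP/(_ w) : form_dyad f u r = 0.
    apply: P0; split=> [t s|q Rq]; rewrite form_dyadE.
      by rewrite linearZl_LR linearZr_LR /=; have [-> ->] := Rr s; rewrite mulr0.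
    by have [_ ->] := Rq u; rewrite scale0r.
  rewrite form_dyadE zero_lfunE => /eqP.
  by rewrite scaler_eq0 (negPf r0) orbF => /eqP.
have id0 : \1%VF = 0 :> 'End(V).
  apply: lie_form_central_eq0 ss _ _ => [|x _].
    by apply/mem_lie_form => v w; rewrite !f0 oppr0.
  by rewrite /lie_bracket comp_lfun1l comp_lfun1r subrr.
by case/negP: r0; rewrite -[r]id_lfunE id0 zero_lfunE.
Qed.

(** The coefficients of a polynomial vector of degree less than n in the kernel of
    the pencil f(v,w) - t f(w,v). *)
Definition pencil_chain n c :=
  [/\ forall w, f (c 0%N) w = 0,
      forall i w, f (c i.+1) w = f w (c i)
    & forall i, (n <= i)%N -> c i = 0].

(** Both indices can be lowered together until one of them reaches 0. *)
Lemma pencil_chain_isotropic n m c d i j :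
  pencil_chain n c -> pencil_chain m d -> f (c i) (d j) = 0.
Proof.
move=> [c0 cS _] [d0 dS _]; elim: j i => [|j IHj] [|i] //.
  by rewrite cS d0.
by rewrite cS dS.
Qed.

Lemma pencil_chain_stable n c y :
  y \in lie_form f -> pencil_chain n c -> pencil_chain n (y \o c).
Proof.
move=> Ly [c0 cS cn]; split=> [w|i w|i ni] /=; last by rewrite cn ?linear0.
  by rewrite lie_formE // c0 oppr0.
by rewrite lie_formE // cS lie_formE // opprK.
Qed.

Definition chain_elt n c : 'End(V) :=
  \sum_(i < n) form_dyad f (c i.+1) (c i.+1 - c i).

Lemma chain_eltE n c w :
  chain_elt n c w = \sum_(i < n) f (c i.+1) w *: (c i.+1 - c i).
Proof. by rewrite sum_lfunE; apply: eq_bigr => i _; rewrite form_dyadE. Qed.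

(** The defect of invariance is a telescoping sum whose two ends vanish. *)
Lemma mem_chain_elt n c : pencil_chain n.+1 c -> chain_elt n c \in lie_form f.
Proof.
move=> [c0 cS cn]; apply/mem_lie_form => v w; apply/eqP.
rewrite -addr_eq0 !chain_eltE linear_sumlz linear_sumr /= -big_split /=.
pose g i := f (c i.+1) v * f (c i) w.
rewrite (eq_bigr (fun i : 'I_n => g i.+1 - g i)) => [|i _]; last first.
  rewrite linearZl_LR linearZr_LR /= linearBl linearBr /= -!cS /g; ring.
rewrite -(big_mkord predT (fun i => g i.+1 - g i)) telescope_sumr // /g.
by rewrite cn // linear0l mul0r c0 mulr0 subrr.
Qed.

(** The abelian ideal consists of the y in L(f) that kill the span C of all chain
    vectors and map V into C. The second condition is stated by duality, as
    g \o y = 0 for every endomorphism g that kills C, so that the infinite family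
    of chains need not be turned into a subspace. *)
Lemma semisimple_chain_elt0 n c : lie_semisimple (lie_form f) ->
  pencil_chain n.+1 c -> chain_elt n c = 0.
Proof.
move=> ss cc.
pose kills (g : 'End(V)) := forall m d i, pencil_chain m d -> g (d i) = 0.
apply: (@lie_semisimple_abelian_pred _ _ _ (fun y =>
  [/\ y \in lie_form f, kills y & forall g w, kills g -> g (y w) = 0]) ss).
- by move=> y [].
- move=> a y z [Ly ky yk] [Lz kz zk]; split=> [|m d i dd|g w kg].
  + by rewrite rpredD ?rpredZ.
  + by rewrite add_lfunE scale_lfunE (ky _ _ _ dd) (kz _ _ _ dd) scaler0 addr0.
  + by rewrite add_lfunE scale_lfunE linearP /= yk // zk // scaler0 addr0.
- move=> y z Ly [Lz kz zk]; split=> [|m d i dd|g w kg].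
  + exact: lie_form_bracket.
  + rewrite lie_bracketE (kz _ _ _ dd) linear0 sub0r.
    by rewrite (kz _ _ i (pencil_chain_stable Ly dd)) oppr0.
  + rewrite lie_bracketE linearB /= (zk g) // subr0 -[g _]comp_lfunE; apply: zk.
    by move=> m d i dd; rewrite comp_lfunE (kg _ _ i (pencil_chain_stable Ly dd)).
- move=> y z [_ ky yk] [_ kz zk]; apply/lfunP => w.
  by rewrite lie_bracketE yk // zk // subrr zero_lfunE.
- split=> [|m d i dd|g w kg]; first exact: mem_chain_elt.
    rewrite chain_eltE big1 // => j _.
    by rewrite (pencil_chain_isotropic _ _ cc dd) scale0r.
  rewrite chain_eltE linear_sum big1 // => j _.
  by rewrite linearZ linearB /= !(kg _ _ _ cc) subrr scaler0.
Qed.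

(** Induction on the length. When f(c_1,w) <> 0 for some w, the vanishing of
    chain_elt at w is a relation with coefficients b_j whose first one is nonzero.
    The shifted combinations d_k of the chain with these coefficients would begin
    with d_{-1} = 0; so d is a shorter chain, and its last term is a nonzero
    multiple of the last term of c. When f(c_1,-) = 0, c_0 lies in the radical and
    can be dropped. *)
Lemma semisimple_chain0 n c i : (0 < \dim {:V})%N ->
  lie_semisimple (lie_form f) -> pencil_chain n c -> c i = 0.
Proof.
move=> hV ss; elim: n c i => [|n IHn] c i cc; first by case: cc => _ _ ->.
have [c0 cS cn] := cc.
have last0 : c n = 0 -> c i = 0.
  move=> cn0; apply: IHn; split=> // j; rewrite leq_eqVlt.
  by case/predU1P=> [<-|/cn].
have [/last0 //|cn0] := eqVneq (c n) 0.
suff c1 w : f (c 1%N) w = 0.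
  have c00 : c 0%N = 0.
    by apply: semisimple_radical0 => // w; split; rewrite // -cS.
  case: i last0 => [|i] _ //.
  by apply: (IHn (c \o succn)); split=> //= j w; apply: cn.
apply/eqP/negPn/negP => b0.
have n0 : (0 < n)%N.
  by rewrite lt0n; apply: contra b0 => /eqP n0; rewrite cn ?n0 // linear0l.
pose b j := f (c j.+1) w.
have rel : \sum_(j < n) b j *: (c j.+1 - c j) = 0.
  by rewrite -chain_eltE semisimple_chain_elt0 // zero_lfunE.
pose d k := \sum_(j < n) b j *: (c (k + j).+2 - c (k + j).+1).
have dd : pencil_chain n d.
  split=> [v|k v|k nk].
  (* f(d_0,v) is f(v,-) of the left-hand side of rel. *)
  - rewrite -[RHS](linear0r f v) -rel linear_sumlz linear_sumr /=.
    apply: eq_bigr => j _.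
    by rewrite linearZl_LR linearZr_LR /= linearBl linearBr /= !cS.
  - rewrite linear_sumlz linear_sumr /=; apply: eq_bigr => j _.
    by rewrite linearZl_LR linearZr_LR /= linearBl linearBr /= !cS !addSn.
  - rewrite /d big1 // => j _; rewrite !cn ?subrr ?scaler0 //.
      by rewrite ltnS (leq_trans nk) ?leq_addr.
    by rewrite !ltnS (leq_trans nk) // -addnS leq_addr.
have dE : d n.-1 = - (b 0%N *: c n).
  rewrite /d (bigD1 (Ordinal n0)) //= big1 => [|j j0].
    by rewrite addn0 prednK // cn // sub0r scalerN addr0.
  have le_n : (n <= n.-1 + j)%N.
    by rewrite -[leqLHS](prednK n0) -addn1 leq_add2l lt0n -(inj_eq val_inj) in j0 *.
  by rewrite !cn ?subrr ?scaler0 // !ltnS ?(leqW le_n).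
have /eqP := IHn d n.-1 dd.
by rewrite dE oppr_eq0 scaler_eq0 (negPf b0) (negPf cn0).
Qed.

End DegenerateForms.

(** * The pencil of a matrix and its transpose *)

Section TransposePencil.
Variables (F : fieldType) (n : nat) (A : 'M[F]_n).
Implicit Types (X : 'M[F]_n).

Local Notation "M ^P" := (map_mx polyC M) (at level 8, format "M ^P").

Definition transpose_pencil : 'M[{poly F}]_n := A^P - 'X *: (A^T)^P.

Let M := transpose_pencil.
Let d : {poly F} := \det M.

(** An endomorphism of the pair (A, A^T) is a pair (X, Y) with X A = A Y and
    X A^T = A^T Y. Over F(t), (A M^-1, M^-1 A) is one, and it commutes with the
    pairs (X, - X^T) that come from L(f). Subtracting its image under the
    involution (X, Y) |-> (Y^T, X^T) makes it skew, and the adjugate clears the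
    denominators. *)
Definition pencil_skew : 'M[{poly F}]_n :=
  A^P *m \adj M - (A^T)^P *m (\adj M)^T.

Definition pencil_skew_coef k : 'M[F]_n := map_mx (coefp k) pencil_skew.

Lemma coef_mulCmx m p q k (B : 'M[F]_(m, p)) (C : 'M[{poly F}]_(p, q)) :
  map_mx (coefp k) (B^P *m C) = B *m map_mx (coefp k) C.
Proof.
apply/matrixP => i j; rewrite !mxE /= coef_sum; apply: eq_bigr => l _.
by rewrite !mxE coefCM.
Qed.

Lemma coef_mulmxC m p q k (B : 'M[{poly F}]_(m, p)) (C : 'M[F]_(p, q)) :
  map_mx (coefp k) (B *m C^P) = map_mx (coefp k) B *m C.
Proof.
apply/matrixP => i j; rewrite !mxE /= coef_sum; apply: eq_bigr => l _.
by rewrite !mxE coefMC.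
Qed.

Lemma scalemx_cancel (a : {poly F}) m p (B C : 'M[{poly F}]_(m, p)) :
  a != 0 -> a *: B = a *: C -> B = C.
Proof.
move=> a0 /eqP; rewrite -subr_eq0 -scalerBr scalemx_eq0 (negPf a0) subr_eq0.
by move/eqP.
Qed.

Let pencilE : 'X *: (A^T)^P = A^P - M.
Proof. by rewrite opprB addrCA subrr addr0. Qed.

Let MJ : M *m \adj M = d%:M. Proof. exact: mul_mx_adj. Qed.
Let JM : \adj M *m M = d%:M. Proof. exact: mul_adj_mx. Qed.

Hypothesis d0 : d != 0.

(** The relation X M = - M X^T, inverted. *)
Lemma pencil_adj_intertwine X : X *m A = - (A *m X^T) ->
  \adj M *m X^P = - ((X^T)^P *m \adj M).
Proof.
move=> XA.
have XAT : X *m A^T = - (A^T *m X^T).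
  apply: trmx_inj; rewrite linearN /= !trmx_mul !trmxK.
  by rewrite XA opprK.
have XM : X^P *m M = - (M *m (X^T)^P).
  rewrite mulmxBr mulmxBl -scalemxAr -scalemxAl -!map_mxM XAT XA.
  by rewrite !map_mxN scalerN -opprD.
apply: (scalemx_cancel d0).
transitivity (\adj M *m (X^P *m M) *m \adj M).
  by rewrite -!mulmxA MJ !mul_mx_scalar -scalemxAr.
by rewrite XM mulmxN mulNmx mulmxA JM mul_scalar_mx scalerN -scalemxAl.
Qed.

Lemma pencil_skew_commutes X k : X *m A = - (A *m X^T) ->
  X *m pencil_skew_coef k = pencil_skew_coef k *m X.
Proof.
move=> XA; rewrite -coef_mulCmx -coef_mulmxC; congr (map_mx _ _).
have JX := pencil_adj_intertwine XA.
have XJT : (\adj M)^T *m X^P = - ((X^T)^P *m (\adj M)^T).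
  apply: trmx_inj; rewrite linearN /= !trmx_mul !trmxK.
  by rewrite !map_trmx trmxK JX opprK.
rewrite mulmxBr mulmxBl !mulmxA -!map_mxM XA.
rewrite -[_ *m \adj M *m _]mulmxA JX -[_ *m (\adj M)^T *m _]mulmxA XJT.
have -> : X *m A^T = - (A^T *m X^T).
  apply: trmx_inj; rewrite linearN /= !trmx_mul !trmxK.
  by rewrite XA opprK.
by rewrite !map_mxN !mulNmx !mulmxN !map_mxM !mulmxA.
Qed.

(** Multiplied by t, the key identity A adj(M) A^T = A^T adj(M) A (sym) follows by
    replacing t A^T with A - M. *)
Lemma pencil_skew_skew k :
  pencil_skew_coef k *m A = - (A *m (pencil_skew_coef k)^T).
Proof.
have sym : A^P *m \adj M *m (A^T)^P = (A^T)^P *m \adj M *m A^P.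
  apply: (@scalemx_cancel 'X); rewrite ?polyX_eq0 //.
  rewrite scalemxAr !scalemxAl pencilE mulmxBr mulmxBl.
  rewrite [(A^P *m _ - _) *m _]mulmxBl -[_ *m \adj M *m M]mulmxA JM MJ.
  by rewrite mul_mx_scalar mul_scalar_mx.
rewrite [(_ k)^T]map_trmx -coef_mulCmx -coef_mulmxC -map_mxN; congr (map_mx _ _).
rewrite linearB /= !trmx_mul trmxK mulmxBl mulmxBr.
rewrite !map_trmx !trmxK !mulmxA.
rewrite opprB; congr (_ - _); have := congr1 trmx sym.
by rewrite !trmx_mul !map_trmx !trmxK !mulmxA => ->.
Qed.

(** From A adj(M) = A^T adj(M)^T, a row killed by A is killed by A^T adj(M)^T, hence
    by det(M) A^T, and conversely; a row killed by both is killed by M. *)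
Lemma pencil_skew_eq0 (r : 'rV[F]_n) : (forall k, pencil_skew_coef k = 0) ->
  (r *m A = 0 -> r = 0) /\ (r *m A^T = 0 -> r = 0).
Proof.
move=> Z0.
have Z : pencil_skew = 0.
  apply/matrixP => i j; apply/polyP => k.
  by have /matrixP/(_ i j) := Z0 k; rewrite !mxE /= coef0.
have inj m (v : 'rV[{poly F}]_m) : d *: v = 0 -> v = 0.
  by move=> dv; apply: (scalemx_cancel d0); rewrite dv scaler0.
have rM : r^P *m A^P = 0 -> r^P *m (A^T)^P = 0 -> r = 0.
  move=> rA rAT; have r0 : r^P = 0.
    apply: inj; rewrite -mul_mx_scalar -MJ mulmxA mulmxBr -scalemxAr rA rAT.
    by rewrite scaler0 subr0 mul0mx.
  apply/rowP => i; have /rowP/(_ i) := r0; rewrite !mxE.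
  by move/polyC_inj.
have rZ : r^P *m A^P *m \adj M = r^P *m (A^T)^P *m (\adj M)^T.
  by apply/eqP; rewrite -subr_eq0 -!mulmxA -mulmxBr -/pencil_skew Z mulmx0.
split=> rA0.
  have rA : r^P *m A^P = 0 by rewrite -map_mxM rA0 map_mx0.
  apply: rM => //; apply: inj; rewrite -mul_mx_scalar -tr_scalar_mx -MJ.
  by rewrite trmx_mul mulmxA -rZ rA !mul0mx.
have rA : r^P *m (A^T)^P = 0 by rewrite -map_mxM rA0 map_mx0.
apply: rM => //; apply: inj; rewrite -mul_mx_scalar -JM.
by rewrite mulmxA rZ rA !mul0mx.
Qed.
End TransposePencil.

(** * Semisimplicity forces non-degeneracy *)

Section GramMatrix.
Variables (F : fieldType) (V : vectType F) (f : {biscalar V}).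
Implicit Types (x : 'End(V)) (v w : V).

Local Notation n := (\dim {:V}).
Local Notation e := (vbasis {:V}).
Local Notation "M ^P" := (map_mx polyC M) (at level 8, format "M ^P").
Let eP : basis_of {:V} e := vbasisP _.

Definition gram : 'M[F]_n := \matrix_(i, j) f e`_i e`_j.

Lemma form_gram v w : f v w = (rVof e v *m gram *m (rVof e w)^T) 0 0.
Proof.
rewrite {1}(coord_vbasis (memvf v)) {1}(coord_vbasis (memvf w)) linear_sumlz.
rewrite -mulmxA mxE; apply: eq_bigr => i _.
rewrite linear_sumr !mxE mulr_sumr; apply: eq_bigr => j _.
by rewrite linearZl_LR linearZr_LR /= !mxE [f _ _ * _]mulrC.
Qed.

Lemma form_gramT v w : f v w = (rVof e w *m gram^T *m (rVof e v)^T) 0 0.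
Proof.
rewrite form_gram; set B := _ *m _ *m _.
have -> : B 0 0 = B^T 0 0 by rewrite [RHS]mxE.
by rewrite !trmx_mul trmxK mulmxA.
Qed.

Lemma gram_eq0l v : (forall w, f v w = 0) <-> rVof e v *m gram = 0.
Proof.
split=> [v0|v0 w]; last by rewrite form_gram v0 mul0mx mxE.
apply/rowP => j; have := v0 e`_j; rewrite form_gram rVofE // trmx_delta.
by rewrite -colE !mxE.
Qed.

Lemma gram_eq0r v : (forall w, f w v = 0) <-> rVof e v *m gram^T = 0.
Proof.
split=> [v0|v0 w]; last by rewrite form_gramT v0 mul0mx mxE.
apply/rowP => j; have := v0 e`_j; rewrite form_gramT rVofE // trmx_delta.
by rewrite -colE !mxE.
Qed.

Lemma mem_lie_form_gram x : x \in lie_form f <->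
  mxof e e x *m gram = - (gram *m (mxof e e x)^T).
Proof.
have fl v w : f (x v) w = (rVof e v *m (mxof e e x *m gram) *m (rVof e w)^T) 0 0.
  by rewrite form_gram (rVof_app e eP) mulmxA.
have fr v w :
    f v (x w) = (rVof e v *m (gram *m (mxof e e x)^T) *m (rVof e w)^T) 0 0.
  by rewrite form_gram (rVof_app e eP) trmx_mul !mulmxA.
split=> [Lx|xA]; last first.
  by apply/mem_lie_form => v w; rewrite fl xA mulmxN mulNmx mxE -fr.
apply/matrixP => i j; have := lie_formE e`_i e`_j Lx.
rewrite fl fr !rVofE // -!rowE trmx_delta -!colE mxE mxE => ->.
by rewrite !mxE.
Qed.

(** The chain is made of the coefficients of a polynomial row r with r M = 0; its
    term i is the leading coefficient of a nonzero entry of r, so that it is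
    nonzero. *)
Lemma singular_pencil_chain : \det (transpose_pencil gram) = 0 ->
  exists m c i, pencil_chain f m c /\ c i != 0.
Proof.
move/eqP/det0P => [r r0 rM].
pose rk k : 'rV[F]_n := map_mx (coefp k) r.
pose c k := vecof e (rk k).
have cE k : rVof e (c k) = rk k by rewrite vecofK.
have rE : r *m gram^P = 'X *: (r *m (gram^T)^P).
  by apply/eqP; rewrite -subr_eq0 scalemxAr -mulmxBr -/(transpose_pencil _) rM.
have rk0 : rk 0%N *m gram = 0.
  by rewrite -coef_mulmxC rE; apply/rowP => j; rewrite !mxE /= coefXM.
have rkS k : rk k.+1 *m gram = rk k *m gram^T.
  by rewrite -!coef_mulmxC rE; apply/rowP => j; rewrite !mxE /= coefXM.
have [j rj0] : exists j, r 0 j != 0.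
  apply/existsP; apply: contraNT r0 => /existsPn rj.
  by apply/eqP/rowP => j; rewrite mxE; apply/eqP/negPn/rj.
exists (\max_l size (r 0%R l)), c, (size (r 0 j)).-1; split; last first.
  rewrite vecof_eq0 //; apply: contraNneq rj0 => /rowP/(_ j).
  by rewrite !mxE /= -lead_coefE => /eqP; rewrite lead_coef_eq0.
split=> [|k w|k mk].
- by apply/gram_eq0l; rewrite cE.
- by rewrite form_gram [RHS]form_gramT !cE rkS.
- rewrite /c; suff -> : rk k = 0 by rewrite linear0.
  apply/rowP => l; rewrite !mxE /= nth_default //.
  by apply: leq_trans mk; apply: (leq_bigmax (F := fun j => size (r 0%R j))).
Qed.

Lemma semisimple_nondegenerate : (0 < n)%N ->
  lie_semisimple (lie_form f) -> form_nondegenerate f.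
Proof.
move=> hV ss; have d0 : \det (transpose_pencil gram) != 0.
  apply/negP => /eqP/singular_pencil_chain[m [c [i [cc /eqP[]]]]].
  exact: semisimple_chain0 hV ss cc.
have Z0 k : pencil_skew_coef gram k = 0.
  rewrite -[LHS](hommxK eP eP) (_ : hommx _ _ _ = 0) ?linear0 //.
  apply: lie_form_central_eq0 ss _ _ => [|x /mem_lie_form_gram Lx].
    by apply/mem_lie_form_gram; rewrite hommxK //; apply: pencil_skew_skew.
  apply/lfunP => v; rewrite lie_bracketE zero_lfunE !hommxE // (hom_vecof e eP).
  by rewrite (rVof_app e eP) -!mulmxA -(pencil_skew_commutes d0 k Lx) subrr.
have r0 v := pencil_skew_eq0 d0 (rVof e v) Z0.
split=> v.
  by move/gram_eq0l => v0; apply/eqP; rewrite -(rVof_eq0 eP) (r0 v).1.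
by move/gram_eq0r => v0; apply/eqP; rewrite -(rVof_eq0 eP) (r0 v).2.
Qed.

End GramMatrix.

Theorem theorem11p1 (F : fieldType) (V : vectType F)
    (hV : (0 < \dim {:V})%N) (f : {biscalar V}) :
  lie_semisimple (lie_form f) <->
  [/\ 2%N \notin [pchar F],
      form_nondegenerate f
    & exists s : 'End(V),
      let V1 := gen_eigenspace s 1 in
      let Vm1 := gen_eigenspace s (-1) in
      is_asymmetry f s /\
      [/\ form_perp_sum f V1 Vm1,
          form_symmetric_on f V1,
          \dim V1 <> 2%N
        & form_skew_on f Vm1]].
Proof.
have ch2E : (2%N \notin [pchar F]) = (2%:R != 0 :> F) by [].
rewrite ch2E; split=> [ss|[n2 nd [s [_ [perp sym dim skew]]]]].
  have n2 := semisimple_char_neq2 hV ss.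
  have nd := semisimple_nondegenerate hV ss.
  by split=> //; apply: semisimple_nondegenerate_split.
exact: perp_sum_semisimple perp sym dim skew.
Qed.
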